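(* Let $F$ be R. Thompson's group, given by the presentation $\langle x_0,x_1,x_2,\ldots \mid x_jx_i=x_ix_{j+1}\ (0\le i<j)\rangle$, let $\bar{x}_1=x_1x_0^{-1}$, and let $S=\{x_0,x_1,\bar{x}_1\}$, which is a generating set of $F$. Then there exist finite subsets $Y\subset F$ such that, in the Cayley graph of $F$ with respect to $S$, the outer boundary of $Y$ satisfies $\#\partial Y<\#Y$. Equivalently, the generating set $S$ does not have the doubling property: there are finite subsets $Y\subset F$ such that the $1$-neighbourhood $\mathcal{N}_1(Y)=Y(\{1\}\cup S^{\pm1})$ has cardinality strictly less than $2\,\#Y$.
   Context: Cayley graph: for a group $G$ generated by a finite set $A$, the (right) Cayley graph $C(G,A)$ has vertex set $G$ and set of oriented edges $G\times A^{\pm1}$, where the edge $(g,a)$ goes from $g$ to $ga$ and has inverse edge $(ga,a^{-1})$. For a set $Y$ of vertices, its $1$-neighbourhood is the set $B_1(Y)=\mathcal{N}_1(Y)$ of all vertices at distance at most $1$ in the Cayley graph from some vertex of $Y$, i.e. $\mathcal{N}_1(Y)=Y(\{1\}\cup A^{\pm1})$. The outer boundary of $Y$ is $\partial Y=B_1(Y)\setminus Y$. The symbol $\#$ denotes cardinality. *)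

(* Defs.v *)
From HB Require Import structures.
From mathcomp Require Import all_boot finmap.
From mathcomp Require Import boolp.

Set Implicit Arguments.
Unset Strict Implicit.
Unset Printing Implicit Defensive.

Local Open Scope quotient_scope.
Local Open Scope fset_scope.
Local Open Scope group_scope.

(* A letter [(x, false)] stands for the generator [x] and [(x, true)] for its
   formal inverse. *)
Definition word (X : Type) := seq (X * bool).
Definition gen_letter (X : Type) (x : X) : X * bool := (x, false).
Definition inv_word (X : Type) (w : word X) : word X :=
  rev [seq (l.1, ~~ l.2) | l <- w].

Section Presentation.
Variables (X : choiceType) (R : word X -> word X -> Prop).

(* The congruence on words generated by free cancellation and the relations
   [u = v] for [R u v]; its quotient is the group presented by < X | R >. *)
Inductive pres_eq : word X -> word X -> Prop :=
| PresRefl u : pres_eq u u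
| PresSym u v of pres_eq u v : pres_eq v u
| PresTrans u v w of pres_eq u v & pres_eq v w : pres_eq u w
| PresCat u u' v v' of pres_eq u u' & pres_eq v v' : pres_eq (u ++ v) (u' ++ v')
| PresCancel x b : pres_eq [:: (x, b); (x, ~~ b)] [::]
| PresRel u v of R u v : pres_eq u v.

Definition pres_eqb (u v : word X) : bool := `[< pres_eq u v >].

Lemma pres_eqb_refl : reflexive pres_eqb.
Proof. by move=> u; apply/asboolP; apply: PresRefl. Qed.

Lemma pres_eqb_sym : symmetric pres_eqb.
Proof. by move=> u v; apply/asboolP/asboolP; apply: PresSym. Qed.

Lemma pres_eqb_trans : transitive pres_eqb.
Proof. by move=> v u w /asboolP uv /asboolP vw; apply/asboolP/(PresTrans uv). Qed.

Canonical pres_equiv := EquivRel pres_eqb pres_eqb_refl pres_eqb_sym pres_eqb_trans.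

Definition presented_group := {eq_quot pres_equiv}.
HB.instance Definition _ := Choice.on presented_group.
HB.instance Definition _ := Quotient.on presented_group.

Definition pres_class (w : word X) : presented_group := \pi_presented_group w.

Lemma pres_classP (u v : word X) : pres_class u = pres_class v <-> pres_eq u v.
Proof.
split=> [/eqmodP/asboolP //|uv].
by apply/(@eqmodP _ pres_equiv); apply/asboolP.
Qed.

Lemma pres_class_repr (g : presented_group) : pres_class (repr g) = g.
Proof. exact: reprK. Qed.

Lemma inv_word_cons l (w : word X) : inv_word (l :: w) = inv_word w ++ [:: (l.1, ~~ l.2)].
Proof. by rewrite /inv_word /= rev_cons cats1. Qed.

Lemma inv_word_cat (u v : word X) : inv_word (u ++ v) = inv_word v ++ inv_word u.
Proof. by rewrite /inv_word map_cat rev_cat. Qed.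

Lemma inv_wordK : involutive (@inv_word X).
Proof.
elim=> [//|[x b] w IH].
by rewrite inv_word_cons inv_word_cat IH /inv_word /= negbK.
Qed.

Lemma pres_eq_mulwV (w : word X) : pres_eq (w ++ inv_word w) [::].
Proof.
elim: w => [|l w IH]; first exact: PresRefl.
have -> : (l :: w) ++ inv_word (l :: w)
    = [:: l] ++ (w ++ inv_word w) ++ [:: (l.1, ~~ l.2)].
  by rewrite inv_word_cons -cat1s !catA.
apply: (PresTrans (PresCat (PresRefl _) (PresCat IH (PresRefl _)))).
by case: l => x b; apply: PresCancel.
Qed.

Lemma pres_eq_mulVw (w : word X) : pres_eq (inv_word w ++ w) [::].
Proof. by rewrite -{2}[w]inv_wordK; apply: pres_eq_mulwV. Qed.

Lemma pres_eq_inv (u v : word X) : pres_eq u v -> pres_eq (inv_word u) (inv_word v).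
Proof.
move=> uv; rewrite -[inv_word u]cats0.
apply: (PresTrans (PresCat (PresRefl _) (PresSym (pres_eq_mulwV v)))).
rewrite catA -[X in pres_eq _ X]cat0s.
apply: PresCat (PresRefl _).
by apply: PresTrans (pres_eq_mulVw u); apply: PresCat (PresRefl _) (PresSym uv).
Qed.

Definition pres_one : presented_group := pres_class [::].
Definition pres_mul (g h : presented_group) : presented_group :=
  pres_class (repr g ++ repr h).
Definition pres_inv (g : presented_group) : presented_group :=
  pres_class (inv_word (repr g)).

Lemma repr_class (w : word X) : pres_eq (repr (pres_class w)) w.
Proof. by apply/pres_classP; rewrite pres_class_repr. Qed.

Lemma pres_mulE (u v : word X) :
  pres_mul (pres_class u) (pres_class v) = pres_class (u ++ v).
Proof. by apply/pres_classP; apply: PresCat; apply: repr_class. Qed.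

Lemma pres_invE (u : word X) : pres_inv (pres_class u) = pres_class (inv_word u).
Proof. by apply/pres_classP; apply/pres_eq_inv/repr_class. Qed.

Lemma pres_mulA : associative pres_mul.
Proof.
move=> g h k.
by rewrite -[g]pres_class_repr -[h]pres_class_repr -[k]pres_class_repr !pres_mulE catA.
Qed.

Lemma pres_mul1g : left_id pres_one pres_mul.
Proof. by move=> g; rewrite -[g]pres_class_repr pres_mulE. Qed.

Lemma pres_mulg1 : right_id pres_one pres_mul.
Proof. by move=> g; rewrite -[g]pres_class_repr pres_mulE cats0. Qed.

Lemma pres_mulVg : left_inverse pres_one pres_inv pres_mul.
Proof.
move=> g; rewrite -[g]pres_class_repr pres_invE pres_mulE.
exact/pres_classP/pres_eq_mulVw.
Qed.

Lemma pres_mulgV : right_inverse pres_one pres_inv pres_mul.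
Proof.
move=> g; rewrite -[g]pres_class_repr pres_invE pres_mulE.
exact/pres_classP/pres_eq_mulwV.
Qed.

HB.instance Definition _ := isGroup.Build presented_group
  pres_mulA pres_mul1g pres_mulg1 pres_mulVg pres_mulgV.

Definition pres_gen (x : X) : presented_group := pres_class [:: gen_letter x].

End Presentation.

Inductive thompson_rel : word nat -> word nat -> Prop :=
  ThompsonRel (i j : nat) of (i < j)%N :
    thompson_rel [:: gen_letter j; gen_letter i] [:: gen_letter i; gen_letter j.+1].

Definition thompsonF : groupType := presented_group thompson_rel.
Definition xF (i : nat) : thompsonF := pres_gen thompson_rel i.

Lemma xF_rel (i j : nat) : (i < j)%N -> xF j * xF i = xF i * xF j.+1.
Proof.
move=> ij; rewrite /xF /pres_gen [LHS]pres_mulE [RHS]pres_mulE.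
by apply/pres_classP; apply: PresRel; apply: ThompsonRel.
Qed.

Section Cayley.
Variable G : groupType.
Implicit Types (A Y : {fset G}) (g h : G).

(* [A] generates [G]: the only subgroup of [G] containing [A] is [G]. *)
Definition generates A : Prop :=
  forall H : {pred G}, group_closed H -> {subset A <= H} -> forall g, g \in H.

Definition sym_set A : {fset G} := A `|` [fset a^-1 | a in A].

(* There is an oriented edge (g, a), with a in A^{+-1}, from g to h = g a. *)
Definition cayley_adj A : rel G :=
  [rel g h | [exists a : sym_set A, h == g * val a]].

Definition cayley_dist_le A (n : nat) g h : Prop :=
  exists p : seq G, [/\ path (cayley_adj A) g p, last g p = h & (size p <= n)%N].

(* Y ({1} U A^{+-1}); it is the set of vertices at distance at most 1 from Y
   by [nbhd1P]. *)
Definition nbhd1 A Y : {fset G} := [fset y * a | y in Y, a in 1 |` sym_set A].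

Definition outer_boundary A Y : {fset G} := nbhd1 A Y `\` Y.

Definition doubling_property A : Prop :=
  forall Y, (2 * #|` Y| <= #|` nbhd1 A Y|)%N.

Lemma nbhd1P A Y h :
  h \in nbhd1 A Y <-> exists2 y, y \in Y & cayley_dist_le A 1 y h.
Proof.
split=> [/imfset2P [y /= yY [a /= aA ->]]|[y yY [p [yp <- sz_p]]]].
- exists y => //; move: aA; rewrite in_fset1U => /orP [/eqP ->|aS].
    by exists [::]; rewrite /= mulg1.
  exists [:: y * a]; split=> //=; rewrite andbT.
  by apply/existsP; exists [` aS].
- apply/imfset2P; exists y => //.
  case: p yp sz_p => [_ _|k [|//]] /=.
    by exists 1; rewrite ?mulg1 //= in_fset1U eqxx.
  rewrite andbT => /existsP [a /eqP ->] _.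
  by exists (val a) => //=; rewrite in_fset1U (valP a) orbT.
Qed.

End Cayley.

Definition S_F : {fset thompsonF} := [fset xF 0; xF 1; xF 1 * (xF 0)^-1].

(* Main.v *)
(* Inverses of elements of [F] are read as forests of binary trees with a
   pointer, as in the work of Belk and Brown; a pointed forest is a zipper [(L, R)],
   the pointer being at the head of [R]. Left multiplication by [x_0] moves the
   pointer, [x_1] joins the pointed tree to the next one and [x_1 x_0^-1] joins it
   to the previous one. Let [Y] consist of the zippers with [n] leaves whose trees
   have height at most [k]. Away from the ends of the forest, every neighbour of
   [Y] either has a pointed tree that is a leaf or a join of two allowed trees, or
   comes from cutting a pointed leaf in one of two ways. If [b_n] and [a_n] count
   zippers and forests with [n] leaves, the [1]-neighbourhood of [Y] therefore has
   at most [b_n + 3 b_(n-1) + 21 a_n] elements. Were this at least [2 b_n] for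
   all [n], multiplying by [x^n] and summing would give [(1 - 3 x) A^2 <= 21 A]
   for [A = 1 / (1 - w)] the generating function of forests and [w] that of trees.
   For [k = 14] one has [w = 1] at some [x < 3 / 10], so [A] is unbounded while
   [1 - 3 x >= 1 / 10], a contradiction. *)

From HB Require Import structures.
Require Import Defs.
From mathcomp Require Import all_boot finmap all_order all_algebra realalg.
From mathcomp Require Import boolp zify ring lra.

Set Implicit Arguments.
Unset Strict Implicit.
Unset Printing Implicit Defensive.

Local Open Scope fset_scope.

(** * Binary trees and their leaves *)

Inductive tree := Leaf | Node of tree & tree.
HB.instance Definition _ := gen_eqMixin tree.

Fixpoint leaves (T : tree) : nat :=
  if T is Node a b then leaves a + leaves b else 1.

Definition forest_leaves (f : seq tree) : nat := sumn (map leaves f).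

Definition zipper_leaves (z : seq tree * seq tree) : nat :=
  forest_leaves z.1 + forest_leaves z.2.

Lemma leaves_gt0 T : 0 < leaves T.
Proof. by elim: T => //= a IHa b IHb; rewrite addn_gt0 IHa. Qed.

(** * The action on sequences *)

(* A bijection [nat * nat -> nat], inverted by [code_fst] and [code_snd]. With it
   [x_i] acts on sequences by merging the entries [i] and [i + 1]. *)
Definition pair_code (a b : nat) : nat := (2 ^ a * b.*2.+1).-1.
Definition code_fst (n : nat) : nat := logn 2 n.+1.
Definition code_snd (n : nat) : nat := (n.+1 %/ 2 ^ logn 2 n.+1)./2.

Lemma pair_codeS a b : (pair_code a b).+1 = 2 ^ a * b.*2.+1.
Proof. by rewrite /pair_code prednK // muln_gt0 expn_gt0. Qed.

Lemma logn2_pair_code a b : logn 2 (2 ^ a * b.*2.+1) = a.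
Proof.
by rewrite mulnC logn_Gauss ?pfactorK // coprime2n /= odd_double.
Qed.

Lemma pair_codeK1 a b : code_fst (pair_code a b) = a.
Proof. by rewrite /code_fst pair_codeS logn2_pair_code. Qed.

Lemma pair_codeK2 a b : code_snd (pair_code a b) = b.
Proof.
rewrite /code_snd pair_codeS logn2_pair_code mulKn ?expn_gt0 //.
by rewrite -[b.*2.+1]add1n (half_bit_double b true).
Qed.

Lemma code_splitK n : pair_code (code_fst n) (code_snd n) = n.
Proof.
apply: succn_inj; rewrite pair_codeS /code_fst /code_snd.
set m := n.+1; set d := m %/ _.
have dvd_m : 2 ^ logn 2 m %| m by apply: pfactor_dvdnn.
have odd_d : odd d.
  apply: contraT; rewrite -dvdn2 => /(dvdn_mul (dvdnn (2 ^ logn 2 m))).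
  by rewrite [_ * d]mulnC divnK // -expnSr pfactor_dvdn // ltnn.
by have := odd_double_half d; rewrite odd_d add1n => ->; rewrite mulnC divnK.
Qed.

Lemma pair_code_gt1 a b : 0 < a -> 0 < b -> 1 < pair_code a b.
Proof.
move=> a0 b0; rewrite -ltnS pair_codeS.
apply: (@leq_trans (2 ^ 1 * 3)) => //; apply: leq_mul; first by rewrite leq_exp2l.
by lia.
Qed.

Definition merge_at (i : nat) (s : nat -> nat) (n : nat) : nat :=
  if n < i then s n else if n == i then pair_code (s i) (s i.+1) else s n.+1.

Definition split_at (i : nat) (s : nat -> nat) (n : nat) : nat :=
  if n < i then s n else if n == i then code_fst (s i)
  else if n == i.+1 then code_snd (s i) else s n.-1.

Lemma merge_atK i : cancel (merge_at i) (split_at i).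
Proof.
move=> s; apply/funext => n; rewrite /split_at /merge_at ltnn eqxx.
case: ltnP => // le_in; case: eqP => [->|]; first exact: pair_codeK1.
move=> ne; case: eqP => [->|ne']; first exact: pair_codeK2.
have -> : (n.-1 < i) = false by lia.
have -> : (n.-1 == i) = false by lia.
by congr s; lia.
Qed.

Lemma split_atK i : cancel (split_at i) (merge_at i).
Proof.
move=> s; apply/funext => n; rewrite /split_at /merge_at ltnn eqxx.
case: ltnP => // le_in; case: eqP => [->|ne].
  have -> : (i.+1 < i) = false by lia.
  by rewrite eqxx gtn_eqF // code_splitK.
have -> : (n.+1 < i) = false by lia.
have -> : (n.+1 == i) = false by lia.
by have -> : (n.+1 == i.+1) = false by lia.
Qed.

(** This is the defining relation of F: merging at [i] first moves the pair at [j.+1] down to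
    [j]. *)
Lemma merge_at_comm i j s : i < j ->
  merge_at j (merge_at i s) = merge_at i (merge_at j.+1 s).
Proof.
move=> ij; apply/funext => n; rewrite /merge_at.
by repeat case: ifP => //; lia.
Qed.

Definition letter_act (l : nat * bool) : (nat -> nat) -> nat -> nat :=
  if l.2 then split_at l.1 else merge_at l.1.

Definition word_act (w : word nat) (s : nat -> nat) : nat -> nat :=
  foldr letter_act s w.

Lemma word_act_pres_eq u v :
  pres_eq thompson_rel u v -> word_act u =1 word_act v.
Proof.
elim=> {u v} //.
- by move=> u v _ IH s; rewrite IH.
- by move=> u v w _ IH _ IH' s; rewrite IH.
- move=> u u' v v' _ IH _ IH' s.
  by rewrite /word_act !foldr_cat [foldr _ s v]IH' [LHS]IH.
- by move=> x [] s; rewrite /word_act /letter_act /= ?merge_atK ?split_atK.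
- by move=> _ _ [i j ij] s; rewrite /word_act /letter_act /= merge_at_comm.
Qed.

Definition act (g : thompsonF) : (nat -> nat) -> nat -> nat := word_act (repr g).

(** * Elements of pointed forests *)

Section ForestElements.
Local Open Scope group_scope.
Variables (G : groupType) (x : nat -> G).

(* [tree_elt T j] merges the entries of a sequence from position [j] on along [T].
   The trees of a zipper occupy the positions from [1] on, and [x 0 ^+ t] absorbs
   the [t] trees to the left of the pointer into entry [0]. *)
Fixpoint tree_elt (T : tree) (j : nat) : G :=
  if T is Node a b then x j * (tree_elt b j.+1 * tree_elt a j) else 1.

Fixpoint forest_elt (f : seq tree) (j : nat) : G :=
  if f is T :: f' then forest_elt f' j.+1 * tree_elt T j else 1.

Definition zipper_elt (z : seq tree * seq tree) : G :=
  x 0 ^+ size z.1 * forest_elt (catrev z.1 z.2) 1.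

Hypothesis x_rel : forall i j, (i < j)%N -> x j * x i = x i * x j.+1.

(** [tree_elt T j] is a product of generators of index at least [j], so the relation applies to each
    factor in turn. *)
Lemma tree_elt_shift T i j : (i < j)%N ->
  tree_elt T j * x i = x i * tree_elt T j.+1.
Proof.
elim: T j => [|a IHa b IHb] j ij /=; first by rewrite mul1g mulg1.
by rewrite -!mulgA IHa // [_ * (x i * _)]mulgA IHb ?(leqW ij) // !mulgA x_rel.
Qed.

Lemma forest_elt_shift f i j : (i < j)%N ->
  forest_elt f j * x i = x i * forest_elt f j.+1.
Proof.
elim: f j => [|T f IH] j ij /=; first by rewrite mul1g mulg1.
by rewrite -mulgA tree_elt_shift // mulgA IH ?(leqW ij) // !mulgA.
Qed.

Lemma forest_elt_cat f1 f2 j :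
  forest_elt (f1 ++ f2) j = forest_elt f2 (j + size f1) * forest_elt f1 j.
Proof.
elim: f1 j => [|T f1 IH] j /=; first by rewrite addn0 mulg1.
by rewrite IH mulgA addSnnS.
Qed.

Lemma x0_shift t j : x j.+1 * x 0 ^+ t = x 0 ^+ t * x (j.+1 + t).
Proof.
elim: t j => [|t IH] j; first by rewrite addn0 mul1g mulg1.
by rewrite expgS mulgA x_rel // -mulgA IH mulgA addSnnS.
Qed.

Lemma zipper_elt_move L T R :
  zipper_elt (T :: L, R) = x 0 * zipper_elt (L, T :: R).
Proof. by rewrite /zipper_elt /= expgS mulgA. Qed.

(** Passing [x 0 ^+ size L] turns [x 1] into the generator at the position of the pointed tree; the
    trees further right then shift by one, two roots having become one. *)
Lemma zipper_elt_node L a b R :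
  zipper_elt (L, Node a b :: R) = x 1 * zipper_elt (L, a :: b :: R).
Proof.
rewrite /zipper_elt /= mulgA x0_shift -mulgA; congr (_ * _).
rewrite !catrevE !forest_elt_cat size_rev /=; set n := (1 + size L)%N.
by rewrite !mulgA -forest_elt_shift.
Qed.

End ForestElements.

Notation zipF := (zipper_elt xF).

(** * Recovering a zipper from its element *)

Section ActGroup.
Local Open Scope group_scope.

Lemma act_class w : act (pres_class thompson_rel w) = word_act w.
Proof. by apply/funext; apply: word_act_pres_eq; apply: repr_class. Qed.

Lemma actM g h s : act (g * h) s = act g (act h s).
Proof.
rewrite -[g](pres_class_repr) -[h](pres_class_repr) [_ * _]pres_mulE !act_class.
by rewrite /word_act foldr_cat.
Qed.

Lemma act1 s : act 1 s = s.
Proof. by rewrite [LHS]/= /act -/(act _) [1]/(pres_class _ _) act_class. Qed.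

Lemma act_xF i s : act (xF i) s = merge_at i s.
Proof. by rewrite /xF /pres_gen act_class. Qed.

End ActGroup.

(** A leaf has value 1, not 0: since [pair_code 0 0 = 0], the value 0 would not tell
    [Node Leaf Leaf] from [Leaf]. *)
Fixpoint tree_val (T : tree) : nat :=
  if T is Node a b then pair_code (tree_val a) (tree_val b) else 1.

Lemma tree_val_gt0 T : 0 < tree_val T.
Proof. by elim: T => //= a IHa b IHb; apply: ltnW; apply: pair_code_gt1. Qed.

Lemma tree_val_inj : injective tree_val.
Proof.
have gt1 a b := pair_code_gt1 (tree_val_gt0 a) (tree_val_gt0 b).
elim=> [|a IHa b IHb] [|c d] //= E.
- by have := gt1 c d; rewrite -E.
- by have := gt1 a b; rewrite E.
- congr Node; [apply: IHa|apply: IHb].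
    by have := congr1 code_fst E; rewrite !pair_codeK1.
  by have := congr1 code_snd E; rewrite !pair_codeK2.
Qed.

Lemma act_tree_elt T j s : (forall i, j <= i -> s i = 1) ->
  act (tree_elt xF T j) s = fun i => if i == j then tree_val T else s i.
Proof.
elim: T j s => [|a IHa b IHb] j s s1 /=.
  by rewrite act1; apply/funext=> i; case: eqP => // ->; rewrite s1.
rewrite !actM act_xF IHa // IHb => [|i ji]; last by rewrite s1 ?ifF //; lia.
apply/funext=> i; rewrite /merge_at !eqxx /=.
have -> : (j == j.+1) = false by lia.
case: ltnP => ij; first by rewrite !ifF //; lia.
by case: (i =P j) => // ne; rewrite !ifF ?s1 //; lia.
Qed.

Lemma act_forest_elt f j s : (forall i, j <= i -> s i = 1) ->
  act (forest_elt xF f j) s =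
  fun i => if i < j then s i else tree_val (nth Leaf f (i - j)).
Proof.
elim: f j s => [|T f IH] j s s1 /=.
  rewrite act1; apply/funext=> i; case: ltnP => // ji.
  by rewrite s1 // nth_nil.
rewrite actM act_tree_elt // IH => [|i ji]; last by rewrite s1 ?ifF //; lia.
apply/funext=> i; rewrite ltnS; case: (ltngtP i j) => // [ji|->].
  by rewrite -(subnSK ji).
by rewrite subnn.
Qed.

(** The tree formed in entry 0 when [x 0 ^+ size L] absorbs the trees left of the pointer, the
    nearest one last. *)
Fixpoint comb (L : seq tree) : tree :=
  if L is T :: L' then Node (comb L') T else Leaf.

Lemma comb_inj : injective comb.
Proof. by elim=> [|T L IH] [|T' L'] //= [/IH -> ->]. Qed.

Lemma act_zipper_elt L R :
  act (zipF (L, R)) (fun=> 1) =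
  fun i => if i is i'.+1 then tree_val (nth Leaf R i') else tree_val (comb L).
Proof.
elim: L R => [|T L IH] R.
  rewrite /zipper_elt /= mul1g act_forest_elt //.
  by apply/funext=> -[|i] //=; rewrite subn1.
rewrite zipper_elt_move actM IH act_xF.
by apply/funext=> -[|i].
Qed.

Lemma forest_leaves_eq0 f : forest_leaves f = 0 -> f = [::].
Proof. by case: f => //= T f; rewrite /forest_leaves /=; have := leaves_gt0 T; lia. Qed.

(** Trailing leaves are invisible to [nth Leaf]; the equal leaf counts rule out a discrepancy
    there. *)
Lemma forest_nth_inj f1 f2 : forest_leaves f1 = forest_leaves f2 ->
  (forall i, nth Leaf f1 i = nth Leaf f2 i) -> f1 = f2.
Proof.
elim: f1 f2 => [|T1 f1 IH] [|T2 f2] // E H.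
- by rewrite [RHS]forest_leaves_eq0.
- by rewrite [LHS]forest_leaves_eq0.
have := H 0; rewrite /= => ET; rewrite ET; congr cons; apply: IH.
  by move: E; rewrite /forest_leaves /= ET => /addnI.
by move=> i; have := H i.+1.
Qed.

(** Acting on the constant sequence 1 shows [L] in entry 0 and [R], up to trailing leaves, in the
    others. *)
Lemma zipper_elt_inj z1 z2 : zipper_leaves z1 = zipper_leaves z2 ->
  zipF z1 = zipF z2 -> z1 = z2.
Proof.
case: z1 z2 => [L1 R1] [L2 R2]; rewrite /zipper_leaves /= => El E.
have := congr1 (fun g => act g (fun=> 1)) E; rewrite !act_zipper_elt => Ea.
have EL : L1 = L2.
  by apply/comb_inj/tree_val_inj; have := congr1 (fun s => s 0) Ea.
congr pair => //; apply: forest_nth_inj; first by move: El; rewrite EL => /addnI.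
by move=> i; apply: tree_val_inj; have := congr1 (fun s => s i.+1) Ea.
Qed.

(** * Neighbourhoods of the zippers with n leaves *)

Fixpoint trees (k : nat) : seq tree :=
  if k is k'.+1 then Leaf :: [seq Node a b | a <- trees k', b <- trees k']
  else [:: Leaf].

Fixpoint forests (k j : nat) : seq (seq tree) :=
  if j is j'.+1 then [seq T :: f | T <- trees k, f <- forests k j']
  else [:: [::]].

(** Bounding the number of trees makes the list finite; for [n <= N] it holds every forest over
    [trees k] with [n] leaves, as each tree has a leaf. *)
Definition all_forests (k N : nat) : seq (seq tree) :=
  flatten [seq forests k j | j <- iota 0 N.+1].

Definition zippers (k N : nat) : seq (seq tree * seq tree) :=
  [seq (L, R) | L <- all_forests k N, R <- all_forests k N].

Lemma Leaf_trees k : Leaf \in trees k.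
Proof. by case: k => [|k]; rewrite inE eqxx. Qed.

Lemma mem_treesS k T : (T \in trees k.+1) =
  if T is Node a b then (a \in trees k) && (b \in trees k) else true.
Proof.
rewrite inE; case: T => [|a b]; first by rewrite eqxx.
apply/orP/andP => [[/eqP//|/allpairsP[[c d] [/= ck dk [-> ->]]]] //|[ak bk]].
by right; apply/allpairsP; exists (a, b).
Qed.

Lemma trees_le k T : T \in trees k -> T \in trees k.+1.
Proof.
elim: k T => [|k IH] T; first by rewrite inE => /eqP->; apply: Leaf_trees.
by rewrite mem_treesS [in X in _ -> X]mem_treesS; case: T => // a b /andP[/IH-> /IH->].
Qed.

Lemma Node_trees k a b :
  Node a b \in trees k -> (a \in trees k) && (b \in trees k).
Proof. by move/trees_le; rewrite mem_treesS. Qed.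

Lemma trees_uniq k : uniq (trees k).
Proof.
elim: k => //= k IH; apply/andP; split.
  by apply/negP => /allpairsP[[a b] [_ _]].
by apply: allpairs_uniq => // -[a b] [c d] _ _ [-> ->].
Qed.

Lemma mem_forests k j f :
  (f \in forests k j) = (size f == j) && all (mem (trees k)) f.
Proof.
elim: j f => [|j IH] f /=; first by rewrite inE; case: f.
apply/allpairsP/andP => [[[T g] [/= Tk]]|].
  by rewrite IH => /andP[/eqP <- gk] -> /=; rewrite Tk gk eqxx.
case: f => [|T f] [//] /= sf /andP[Tk fk].
by exists (T, f); rewrite IH -(eqn_add2l 1) sf fk.
Qed.

Lemma forests_uniq k j : uniq (forests k j).
Proof.
elim: j => //= j IH.
by apply: allpairs_uniq => //; [apply: trees_uniq|move=> [? ?] [? ?] _ _ [-> ->]].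
Qed.

Lemma mem_all_forests k N f :
  (f \in all_forests k N) = (size f <= N) && all (mem (trees k)) f.
Proof.
apply/flatten_mapP/andP => [[j]|[sf fk]].
  by rewrite mem_iota mem_forests => jN /andP[/eqP sf ->]; rewrite sf -ltnS.
by exists (size f); rewrite ?mem_iota // mem_forests eqxx.
Qed.

Lemma all_forests_uniq k N : uniq (all_forests k N).
Proof.
rewrite /all_forests; elim: (iota 0 _) (iota_uniq 0 N.+1) => //= j s IH.
case/andP=> js us; rewrite cat_uniq forests_uniq IH // andbT.
apply/hasPn => f /flatten_mapP[i]; rewrite !mem_forests.
by move=> i_s' /andP[/eqP fi _]; rewrite fi; case: eqP js => // <-; rewrite i_s'.
Qed.

Lemma zippers_uniq k N : uniq (zippers k N).
Proof.
by apply: allpairs_uniq; rewrite ?all_forests_uniq // => -[? ?] [? ?] _ _ [-> ->].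
Qed.

Lemma mem_zippers k N L R :
  ((L, R) \in zippers k N) =
  (L \in all_forests k N) && (R \in all_forests k N).
Proof.
apply/allpairsP/andP => [[[? ?] /= [? ? [-> ->]]] //|[LN RN]].
by exists (L, R).
Qed.

Lemma size_forest_leaves f : size f <= forest_leaves f.
Proof.
elim: f => //= T f IH; rewrite /forest_leaves /= -add1n.
by rewrite leq_add ?leaves_gt0.
Qed.

Section Neighbourhood.
Local Open Scope group_scope.
Variables (k N n : nat).
Hypothesis nN : (n <= N)%N.

Definition level : seq (seq tree * seq tree) :=
  [seq z <- zippers k N | zipper_leaves z == n].

Definition forest_level : seq (seq tree) :=
  [seq f <- all_forests k N | forest_leaves f == n].

(** Written with a successor so that it is empty for [n = 0]. *)
Definition lower_level : seq (seq tree * seq tree) :=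
  [seq z <- zippers k N | (zipper_leaves z).+1 == n].

Lemma mem_level L R : ((L, R) \in level) =
  [&& all (mem (trees k)) L, all (mem (trees k)) R
    & zipper_leaves (L, R) == n].
Proof.
rewrite mem_filter mem_zippers !mem_all_forests andbC.
case: eqP => [E|]; rewrite ?andbF // !andbT.
have := size_forest_leaves L; have := size_forest_leaves R.
move=> sR sL.
rewrite (leq_trans sL) ?(leq_trans sR) //; apply: leq_trans nN; rewrite -E.
  exact: leq_addl.
exact: leq_addr.
Qed.

Lemma mem_forest_level f : (f \in forest_level) =
  all (mem (trees k)) f && (forest_leaves f == n).
Proof.
rewrite mem_filter mem_all_forests andbC.
case: eqP => [E|]; rewrite ?andbF // !andbT.
by rewrite (leq_trans (size_forest_leaves f)) // E.
Qed.

Lemma mem_lower_level L R : ((L, R) \in lower_level) =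
  [&& all (mem (trees k)) L, all (mem (trees k)) R
    & (zipper_leaves (L, R)).+1 == n].
Proof.
rewrite mem_filter mem_zippers !mem_all_forests andbC.
case: eqP => [E|]; rewrite ?andbF // !andbT.
have := size_forest_leaves L; have := size_forest_leaves R.
move=> sR sL.
rewrite (leq_trans sL) ?(leq_trans sR) //; apply: leq_trans nN; rewrite -E.
  exact/leqW/leq_addl.
exact/leqW/leq_addr.
Qed.

Definition join_marked (z : seq tree * seq tree) : seq tree * seq tree :=
  if z is (L, a :: b :: R) then (L, Node a b :: R) else z.

Definition leaf_marked : seq thompsonF :=
  [seq zipF (z.1, Leaf :: z.2) | z <- lower_level].

(** Contains both the joins of two allowed trees and the level's own zippers pointed at a node,
    since splitting that node stays in the level; one copy of the level pays for both. *)
Definition node_marked : seq thompsonF := [seq zipF (join_marked z) | z <- level].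

(** Covers the zippers of the level with no tree left of the pointer or fewer than two from it on;
    three lists times seven [steps] give the constant 21. *)
Definition end_zippers : seq (seq tree * seq tree) :=
  [seq ([::], f) | f <- forest_level] ++ [seq (f, [::]) | f <- forest_level] ++
  [seq (behead f, [:: head Leaf f]) | f <- forest_level].

Definition steps : seq thompsonF :=
  [:: 1; xF 0; xF 1; xF 1 * (xF 0)^-1;
      (xF 0)^-1; (xF 1)^-1; (xF 1 * (xF 0)^-1)^-1].

(** A pointed leaf cannot be split, so its images under the inverses of [x_1] and [x_1 x_0^-1] are
    kept as formal translates of [leaf_marked]. *)
Definition level_nbhd : seq thompsonF :=
  leaf_marked ++ node_marked ++ [seq (xF 1)^-1 * g | g <- leaf_marked] ++
  [seq (xF 1 * (xF 0)^-1)^-1 * g | g <- leaf_marked] ++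
  [seq a * zipF z | a <- steps, z <- end_zippers].

Lemma size_level_nbhd :
  size level_nbhd = (size level + 3 * size lower_level + 21 * size forest_level)%N.
Proof. by rewrite /level_nbhd /= !(size_cat, size_map) /=; lia. Qed.

Lemma mem_node_marked L a b R : (L, a :: b :: R) \in level ->
  zipF (L, Node a b :: R) \in node_marked.
Proof. by move=> z_lev; apply/mapP; exists (L, a :: b :: R). Qed.

Lemma split_level L a b R : (L, Node a b :: R) \in level ->
  (L, a :: b :: R) \in level.
Proof.
rewrite !mem_level /zipper_leaves /forest_leaves /= -addnA.
by case/and3P => -> /andP[/Node_trees/andP[-> ->] ->] ->.
Qed.

Lemma leaf_level L R : (L, Leaf :: R) \in level -> (L, R) \in lower_level.
Proof.
rewrite mem_level mem_lower_level /zipper_leaves /forest_leaves /=.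
by case/and3P => -> /andP[_ ->]; rewrite addnCA add1n.
Qed.

Lemma mem_marked L T R : (L, T :: R) \in level ->
  (zipF (L, T :: R) \in leaf_marked) || (zipF (L, T :: R) \in node_marked).
Proof.
case: T => [|a b] z_lev; apply/orP; [left|right].
  by apply/mapP; exists (L, R) => //; apply: leaf_level.
exact/mem_node_marked/split_level.
Qed.

Lemma move_level L T R : ((T :: L, R) \in level) = ((L, T :: R) \in level).
Proof.
rewrite !mem_level /zipper_leaves /forest_leaves /=.
rewrite (addnCA (sumn _)) addnA.
by case: (T \in _) => //=; rewrite andbF.
Qed.

Lemma mem_end_zippers z : z \in level ->
  (z.1 == [::]) || (size z.2 < 2)%N -> z \in end_zippers.
Proof.
case: z => L R z_lev; rewrite !mem_cat.
case: L z_lev => [|a L] z_lev /=.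
  move=> _; apply/orP; left; apply/mapP; exists R => //.
  by rewrite mem_forest_level; move: z_lev; rewrite mem_level.
case: R z_lev => [|T [|//]] z_lev _; apply/orP; right; apply/orP.
  left; apply/mapP; exists (a :: L) => //; rewrite mem_forest_level.
  by move: z_lev; rewrite mem_level /zipper_leaves /= addn0.
right; apply/mapP; exists (T :: a :: L) => //; rewrite mem_forest_level.
move: z_lev; rewrite -move_level mem_level => /and3P[-> _].
by rewrite /zipper_leaves addn0.
Qed.

Lemma mem_level_nbhd z a :
  z \in level -> a \in steps -> a * zipF z \in level_nbhd.
Proof.
move=> z_lev a_step; rewrite /level_nbhd 4!mem_cat.
case: (boolP ((z.1 == [::]) || (size z.2 < 2)%N)) => [z_end|].
  do 4 (apply/orP; right); apply/allpairsP; exists (a, z); split => //.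
  exact: mem_end_zippers.
case: z z_lev => [[|c L]] [|b [|d R]] //= z_lev _.
move: a_step; rewrite !inE.
have mk L' T' R' := @mem_marked L' T' R'.
case/or4P => [/eqP->|/eqP->|/eqP->|].
- by rewrite mul1g; case/orP: (mk _ _ _ z_lev) => ->; rewrite ?orbT.
- rewrite -zipper_elt_move; move: z_lev; rewrite -move_level => /mk.
  by case/orP => ->; rewrite ?orbT.
- by rewrite -(zipper_elt_node xF_rel) mem_node_marked ?orbT.
case/or4P => /eqP->.
(* [x_0^-1] steps back to [c], which [x_1] then joins to [b]. *)
- rewrite zipper_elt_move -mulgA mulKg -(zipper_elt_node xF_rel).
  by rewrite mem_node_marked ?orbT // -move_level.
- rewrite zipper_elt_move mulKg; move: z_lev; rewrite move_level => /mk.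
  by case/orP => ->; rewrite ?orbT.
- case: b z_lev => [|u v] z_lev.
    do 2 (apply/orP; right); apply/orP; left; apply: map_f.
    by apply/mapP; exists (c :: L, d :: R) => //; apply: leaf_level.
  rewrite (zipper_elt_node xF_rel) mulKg; move: z_lev => /split_level/mk.
  by case/orP => ->; rewrite ?orbT.
- case: b z_lev => [|u v] z_lev.
    do 3 (apply/orP; right); apply/orP; left; apply: map_f.
    by apply/mapP; exists (c :: L, d :: R) => //; apply: leaf_level.
  rewrite (zipper_elt_node xF_rel) invgM invgK -mulgA mulKg -zipper_elt_move.
  move: z_lev => /split_level; rewrite -move_level => /mk.
  by case/orP => ->; rewrite ?orbT.
Qed.

(** Inverses turn the right multiplications of the Cayley graph into left multiplications of
    zippers. *)
Definition level_set : {fset thompsonF} :=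
  [fset g | g in [seq (zipF z)^-1 | z <- level]].

Lemma card_level_set : #|` level_set| = size level.
Proof.
rewrite card_fseq undup_id ?size_map // map_inj_in_uniq.
  exact/filter_uniq/zippers_uniq.
move=> z1 z2; rewrite !mem_filter => /andP[/eqP E1 _] /andP[/eqP E2 _].
by move/invg_inj; apply: zipper_elt_inj; rewrite E1.
Qed.

Lemma nbhd1_level_set h : h \in nbhd1 S_F level_set -> h^-1 \in level_nbhd.
Proof.
case/imfset2P => y /=; rewrite inE => /mapP[z z_lev ->] [a /=].
move=> a_step ->; rewrite invgM invgK; apply: mem_level_nbhd => //.
move: a_step; rewrite in_fset1U inE => /orP[/eqP->|/orP[|/imfsetP[b /=]]].
- by rewrite invg1 !inE eqxx.
- by rewrite !inE -orbA => /or3P[] /eqP->; rewrite eqxx ?orbT.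
- by rewrite !inE -orbA => /or3P[] /eqP-> ->; rewrite invgK eqxx ?orbT.
Qed.

Lemma card_nbhd1_level_set :
  (#|` nbhd1 S_F level_set| <=
     size level + 3 * size lower_level + 21 * size forest_level)%N.
Proof.
rewrite -size_level_nbhd -(size_map (fun g : thompsonF => g^-1)).
apply: uniq_leq_size; first exact: fset_uniq.
move=> h /nbhd1_level_set h_nb; apply/mapP; exists h^-1 => //.
by rewrite invgK.
Qed.
End Neighbourhood.

(** * Weighted sums *)

Section Weights.
Import Order.TTheory GRing.Theory Num.Theory.
Local Open Scope ring_scope.

(** Grouping terms by exponent lets inequalities between counts for every [n] be summed into one
    between weighted sums. *)
Lemma sum_count_expr (F : pzRingType) (A : Type) (s : seq A) (f : A -> nat)
    (x : F) (M : nat) :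
  \sum_(n < M) (count (fun z => f z == n) s)%:R * x ^+ n =
  \sum_(z <- s | (f z < M)%N) x ^+ f z.
Proof.
elim: s => [|z s IH]; first by rewrite big_nil big1 // => i _; rewrite mul0r.
rewrite big_cons -IH /=; under eq_bigr do rewrite natrD mulrDl.
rewrite big_split /=; case: ltnP => fM.
  congr (_ + _); rewrite (bigD1 (Ordinal fM)) //= eqxx mul1r big1 ?addr0 //.
  move=> i /eqP ne; case: eqP => [fi|]; last by rewrite mul0r.
  by case: ne; apply: val_inj.
rewrite big1 ?add0r // => i _; case: eqP => [fi|]; last by rewrite mul0r.
by have := ltn_ord i; rewrite -fi ltnNge fM.
Qed.

Lemma ler_sum_subset (F : numDomainType) (A : eqType) (s t : seq A)
    (w : A -> F) :
  uniq s -> uniq t -> {subset s <= t} -> (forall z, 0 <= w z) ->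
  \sum_(z <- s) w z <= \sum_(z <- t) w z.
Proof.
move=> us ut st w0; rewrite (bigID (mem s) predT) /= [X in _ + X]big1_seq; last first.
  by move=> z /andP[/negP].
rewrite addr0 [X in _ <= X](bigID (mem s) predT) /=.
have -> : \sum_(z <- s | z \in s) w z = \sum_(z <- t | z \in s) w z.
  rewrite -big_filter -[RHS]big_filter; apply: perm_big.
  apply: uniq_perm; rewrite ?filter_uniq // => z; rewrite !mem_filter.
  by case zs: (z \in s) => //=; rewrite st.
by rewrite lerDl sumr_ge0.
Qed.

Fixpoint tree_weight (F : pzRingType) (x : F) (k : nat) : F :=
  if k is k'.+1 then x + tree_weight x k' ^+ 2 else x.

Section TreeSums.
Variables (F : realFieldType) (x : F).

Lemma sum_trees k : \sum_(T <- trees k) x ^+ leaves T = tree_weight x k.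
Proof.
elim: k => [|k IH]; first by rewrite /= big_seq1.
rewrite /= big_cons /= expr1 big_allpairs_dep /= -IH expr2 mulr_suml.
congr (_ + _); apply: eq_bigr => a _; rewrite mulr_sumr.
by apply: eq_bigr => b _; rewrite exprD.
Qed.

Lemma sum_forests k j :
  \sum_(f <- forests k j) x ^+ forest_leaves f = tree_weight x k ^+ j.
Proof.
elim: j => [|j IH]; first by rewrite /= big_seq1.
rewrite /= big_allpairs_dep /= exprS -IH -sum_trees mulr_suml.
apply: eq_bigr => T _; rewrite mulr_sumr.
by apply: eq_bigr => f _; rewrite exprD.
Qed.

Lemma sum_all_forests k N :
  \sum_(f <- all_forests k N) x ^+ forest_leaves f =
  \sum_(j < N.+1) tree_weight x k ^+ j.
Proof.
rewrite big_flatten big_map -[iota _ _]/(index_iota 0 N.+1) big_mkord.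
by apply: eq_bigr => j _; apply: sum_forests.
Qed.

Lemma sum_zippers k N :
  \sum_(z <- zippers k N) x ^+ zipper_leaves z =
  (\sum_(j < N.+1) tree_weight x k ^+ j) ^+ 2.
Proof.
rewrite big_allpairs_dep -sum_all_forests expr2 mulr_suml.
apply: eq_bigr => L _; rewrite mulr_sumr.
by apply: eq_bigr => R _; rewrite exprD.
Qed.

Lemma all_forests_le k J N : (J <= N)%N ->
  {subset all_forests k J <= all_forests k N}.
Proof.
by move=> JN f; rewrite !mem_all_forests => /andP[/leq_trans-> //].
Qed.

(** The truncated form of [(1 - 3 x) A^2 <= 21 A]: the left side allows [J] trees on each side of
    the pointer, and [N] is large enough for all those zippers to lie in levels up to [N]. *)
Lemma level_sum_le k J N : 0 < x -> 3 * x <= 1 -> (J <= N)%N ->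
  (forall z, z \in zippers k J -> (zipper_leaves z <= N)%N) ->
  (forall n, (n <= N)%N ->
     (size (level k N n) <=
        3 * size (lower_level k N n) + 21 * size (forest_level k N n))%N) ->
  (1 - 3 * x) * (\sum_(j < J.+1) tree_weight x k ^+ j) ^+ 2 <=
  21 * \sum_(j < N.+1) tree_weight x k ^+ j.
Proof.
move=> x0 x_le JN zJ lev.
set B := \sum_(z <- zippers k N | (zipper_leaves z < N.+1)%N) x ^+ zipper_leaves z.
have xX n : 0 <= x ^+ n by rewrite exprn_ge0 // ltW.
have B_ge : (\sum_(j < J.+1) tree_weight x k ^+ j) ^+ 2 <= B.
  rewrite -sum_zippers /B -[leRHS]big_filter; apply: ler_sum_subset => //.
  - exact: zippers_uniq.
  - exact/filter_uniq/zippers_uniq.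
  - move=> [L R] z_J; rewrite mem_filter ltnS zJ //=.
    have sub := all_forests_le JN.
    by move: z_J; rewrite !mem_zippers => /andP[/sub-> /sub->].
set B' := \sum_(z <- zippers k N | ((zipper_leaves z).+1 < N.+1)%N)
             x ^+ (zipper_leaves z).+1.
(* The extra leaf costs a factor [x], and zippers with exactly [N] leaves drop out. *)
have B'_le : B' <= x * B.
  rewrite /B' /B big_mkcond mulr_sumr [leRHS]big_mkcond; apply: ler_sum => z _ /=.
  case: ltnP => [zN|_]; last by case: ifP => // _; rewrite mulr_ge0 // ltW.
  by rewrite ltnW // exprS.
set A := \sum_(f <- all_forests k N | (forest_leaves f < N.+1)%N) x ^+ forest_leaves f.
have A_le : A <= \sum_(j < N.+1) tree_weight x k ^+ j.
  rewrite -sum_all_forests /A big_mkcond; apply: ler_sum => f _ /=.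
  by case: ifP.
have : B <= 3 * B' + 21 * A.
  rewrite /B /B' /A -!sum_count_expr !mulr_sumr -big_split /=.
  apply: ler_sum => n _; rewrite !mulrA -mulrDl ler_wpM2r // -!natrM -natrD ler_nat.
  by have := lev n; rewrite -ltnS ltn_ord !size_filter; apply.
move=> B_le; apply: le_trans (_ : (1 - 3 * x) * B <= _).
  by rewrite ler_wpM2l // subr_ge0.
by rewrite mulrBl mul1r -mulrA; lra.
Qed.
End TreeSums.

(** * Choosing the weight and the level *)

Lemma expr_bernoulli (F : realFieldType) (q : F) n :
  0 <= q <= 1 -> q ^+ n * (1 + n%:R * (1 - q)) <= 1.
Proof.
move=> /andP[q0 q1]; elim: n => [|n IH]; first by rewrite mul0r addr0 mulr1.
apply: le_trans IH; rewrite exprSr -mulrA ler_wpM2l ?exprn_ge0 //.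
rewrite -natr1 -subr_ge0 (_ : _ - _ = (1 - q) ^+ 2 * (1 + n%:R)); last by ring.
by rewrite mulr_ge0 ?sqr_ge0 ?addr_ge0.
Qed.

Lemma small_expr (F : archiRealFieldType) (q : F) :
  0 <= q < 1 -> exists n, q ^+ n <= 1 / 4.
Proof.
move=> /andP[q0 q1]; have q1' : 0 < 1 - q by rewrite subr_gt0.
(* [n > 3 / (1 - q)] makes the factor [1 + n (1 - q)] exceed 4. *)
have /archi_boundP : 0 <= 3 / (1 - q) by rewrite divr_ge0 // ltW.
set n := Num.bound _; rewrite ltr_pdivrMr // => big; exists n.
have := @expr_bernoulli _ q n; rewrite q0 ltW // => /(_ isT).
have := exprn_ge0 n q0; nra.
Qed.

Lemma tree_weight_poly (F : comNzRingType) k :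
  exists p : {poly F}, forall x, p.[x] = tree_weight x k.
Proof.
elim: k => [|k [p pE]]; first by exists 'X => x; rewrite hornerX.
by exists ('X + p ^+ 2) => x; rewrite hornerD hornerX horner_exp pE.
Qed.

(* With [x = 3 / 10] each step adds [(w - 1 / 2) ^+ 2 + (x - 1 / 4) >= 1 / 20]
   to the weight [w]. *)
Lemma tree_weight_ge (F : realFieldType) k :
  3 / 10 + k%:R / 20 <= tree_weight (3 / 10 : F) k.
Proof.
elim: k => [|k IH]; first by rewrite mul0r addr0.
apply: le_trans (_ : tree_weight (3 / 10) k + 1 / 20 <= _).
  by rewrite -[k.+1]addn1 natrD; lra.
rewrite -subr_ge0 /= (_ : _ - _ = (tree_weight (3 / 10) k - 1 / 2) ^+ 2) ?sqr_ge0 //.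
by field.
Qed.

Lemma tree_weight0 (F : pzRingType) k : tree_weight (0 : F) k = 0.
Proof. by elim: k => //= k ->; rewrite expr2 mulr0 addr0. Qed.

Lemma exists_tree_weight (F : rcfType) (q : F) : 0 < q <= 1 ->
  exists2 x, 0 < x <= 3 / 10 & tree_weight x 14 = q.
Proof.
move=> /andP[q0 q1]; have [p pE] := tree_weight_poly F 14.
have [||x /andP[x_ge x_le]] := @poly_ivt _ (p - q%:P) 0 (3 / 10).
- by rewrite divr_ge0.
- rewrite !hornerE !pE tree_weight0 sub0r oppr_le0 ltW //= subr_ge0.
  (* [3 / 10 + 14 / 20 = 1 >= q]: this fixes the height 14. *)
  by apply: le_trans q1 (le_trans _ (tree_weight_ge F 14)); lra.
rewrite rootE !hornerE pE subr_eq0 => /eqP xq; exists x => //.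
rewrite x_le lt_def x_ge andbT /= andbT; apply: contraTneq q0 => x0.
by rewrite -xq x0 tree_weight0 ltxx.
Qed.

(** Meant for [e = 1 - q] and truncated geometric sums [G] and [H]: both have order [1 / e], so
    [G ^+ 2] beats [H] for small [e]. *)
Lemma level_sum_gt (F : realFieldType) (c e G H : F) :
  0 < e -> 0 <= c -> 21 * e < c * (3 / 4) ^+ 2 -> 3 / 4 <= e * G ->
  e * H <= 1 -> 21 * H < c * G ^+ 2.
Proof.
move=> e0 c0 ce eG eH; rewrite -(ltr_pM2l (exprn_gt0 2 e0)).
have -> : e ^+ 2 * (21 * H) = 21 * e * (e * H) by ring.
have -> : e ^+ 2 * (c * G ^+ 2) = c * (e * G) ^+ 2 by ring.
apply: le_lt_trans (_ : 21 * e < _); first by rewrite ler_piMr // mulr_ge0 // ltW.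
apply: lt_le_trans ce _; rewrite ler_wpM2l // lerXn2r // nnegrE ?divr_ge0 //.
by apply: le_trans eG; rewrite divr_ge0.
Qed.

Lemma exists_level : exists k N n, (n <= N)%N /\
  (3 * size (lower_level k N n) + 21 * size (forest_level k N n) <
     size (level k N n))%N.
Proof.
have [q [q0 q1 q_close]] : exists q : realalg,
    [/\ 0 < q, q < 1 & 21 * (1 - q) < 1 / 10 * (3 / 4) ^+ 2].
  (* Below 1, so that the geometric series converges, yet near enough to 1 that
     [21 / 500 < 9 / 160]. *)
  by exists (499 / 500); split; lra.
have [|x /andP[x0 x_le] xq] := @exists_tree_weight _ q.
  by rewrite q0 ltW.
have [|J J_le] := @small_expr _ q; first by rewrite ltW.
(* [J] brings the geometric sum to at least three quarters of its limit; [N] bounds [J] and the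
   leaves of all zippers in [zippers 14 J]. *)
pose N := (J + \max_(z <- zippers 14 J) zipper_leaves z)%N.
have zJ z : z \in zippers 14 J -> (zipper_leaves z <= N)%N.
  by move=> z_J; apply: leq_trans (leq_addl _ _); apply: leq_bigmax_seq.
apply: contrapT => no_level.
have x3 : 1 / 10 <= 1 - 3 * x by lra.
have : (1 - 3 * x) * (\sum_(j < J.+1) q ^+ j) ^+ 2 <= 21 * \sum_(j < N.+1) q ^+ j.
  rewrite -xq; apply: level_sum_le (zJ) _ => //; [lra|exact: leq_addr|].
  move=> n nN; rewrite leqNgt; apply/negP => lev.
  by apply: no_level; exists 14, N, n.
have geom M : (1 - q) * (\sum_(j < M.+1) q ^+ j) = 1 - q ^+ M.+1.
  by rewrite -opprB mulNr -subrX1 opprB.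
have qX n : 0 <= q ^+ n by rewrite exprn_ge0 // ltW.
apply/negP; rewrite -ltNge; apply: (@level_sum_gt _ _ (1 - q)).
- by rewrite subr_gt0.
- by apply: le_trans x3; rewrite divr_ge0.
- by apply: lt_le_trans q_close _; rewrite ler_wpM2r // exprn_ge0 // divr_ge0.
- rewrite geom exprS lerBrDr -lerBrDl.
  apply: le_trans (_ : q ^+ J <= _); first by rewrite ler_piMl ?qX // ltW.
  by apply: le_trans J_le _; lra.
- by rewrite geom lerBlDr lerDl qX.
Qed.
End Weights.

(** * Generation of F and the conclusion *)

Lemma mem_xF (H : {pred thompsonF}) : group_closed H ->
  {subset S_F <= H} -> forall i, xF i \in H.
Proof.
move=> Hgrp SH; have HM := group_closedM Hgrp; have HV := group_closedV Hgrp.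
have H0 : xF 0 \in H by apply: SH; rewrite !inE eqxx.
case=> // i; elim: i => [|i IH]; first by apply: SH; rewrite !inE eqxx orbT.
(* Conjugating by [x_0] raises the index by one. *)
have -> : xF i.+2 = ((xF 0)^-1 * (xF i.+1 * xF 0))%g by rewrite xF_rel // mulKg.
by rewrite HM ?HV // HM.
Qed.

Lemma S_F_generates : generates S_F.
Proof.
move=> H Hgrp SH g; rewrite -[g]pres_class_repr.
have HM := group_closedM Hgrp; have HV := group_closedV Hgrp.
elim: (repr g) => [|[i b] w IH]; first by case: Hgrp.
rewrite -cat1s -pres_mulE; apply: HM IH.
have Hi := mem_xF Hgrp SH i; case: b => //.
by have := HV _ Hi; rewrite [(_^-1)%g]pres_invE.
Qed.

Lemma small_nbhd : exists Y : {fset thompsonF}, (#|` nbhd1 S_F Y| < 2 * #|` Y|)%N.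
Proof.
have [k [N [n [nN lev]]]] := exists_level.
exists (level_set k N n); apply: leq_ltn_trans (card_nbhd1_level_set k nN) _.
by rewrite card_level_set mul2n -addnn -addnA ltn_add2l.
Qed.

Theorem theorem2 :
  [/\ generates S_F,
      exists Y : {fset thompsonF}, (#|` outer_boundary S_F Y| < #|` Y|)%N,
      ~ doubling_property S_F
    & exists Y : {fset thompsonF}, (#|` nbhd1 S_F Y| < 2 * #|` Y|)%N].
Proof.
have [Y Y_small] := small_nbhd; split; [exact: S_F_generates| | |by exists Y].
- exists Y; have sub : Y `<=` nbhd1 S_F Y.
    apply/fsubsetP => y yY; apply/imfset2P; exists y => //.
    by exists 1%g; rewrite ?mulg1 //= in_fset1U eqxx.
  by rewrite /outer_boundary cardfsDS // ltn_subLR ?fsubset_leq_card // addnn -mul2n.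
- by move=> /(_ Y); rewrite leqNgt Y_small.
Qed.
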